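(* Let $(M,d)$ be a complete metric tree and let $A\subseteq M$ be a bounded subset. Then the compact width $a(A,M)$ is attained; that is, there exists a compact subset $X_0\subseteq M$ such that $$\sup_{a\in A}\,\inf_{x\in X_0} d(a,x)=a(A,M).$$
   Context: Metric segment: in a metric space $(M,d)$, a metric segment from $x$ to $y$ is the image of an isometric embedding $\alpha:[a,b]\to M$ of a real interval with $\alpha(a)=x$ and $\alpha(b)=y$; it is denoted $[x,y]$. Metric tree: a metric space $(M,d)$ is a metric tree if for all $x,y,z\in M$: (1) there exists a unique metric segment $[x,y]$ from $x$ to $y$; and (2) if $[x,z]\cap[z,y]=\{z\}$ then $[x,z]\cup[z,y]=[x,y]$. Compact width: for a metric space $(M,d)$, let $\mathcal{X}$ be the set of compact subsets of $M$. For $A\subseteq M$, the compact width of $A$ is $$a(A,M)=\inf_{X\in\mathcal{X}}\,\sup_{a\in A}\,\inf_{x\in X} d(a,x),$$ with values in $[0,\infty]$. *)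

(* Defs.v *)
From HB Require Import structures.
From mathcomp Require Import all_boot all_order all_algebra.
From mathcomp Require Import all_classical all_reals all_analysis.

Set Implicit Arguments.
Unset Strict Implicit.
Unset Printing Implicit Defensive.

Import Order.TTheory GRing.Theory Num.Theory.
Import numFieldNormedType.Exports.

Local Open Scope classical_set_scope.
Local Open Scope ring_scope.

(* The embedding of [a, b] is given by a total function on R, of which only the
   values on [a, b] matter; a <= b makes the interval nonempty. *)
Definition is_metric_segment (R : realType) (M : metricType R)
    (x y : M) (S : set M) : Prop :=
  exists (a b : R) (alpha : R -> M),
    [/\ a <= b,
        forall s t, s \in `[a, b] -> t \in `[a, b] ->
          mdist (alpha s) (alpha t) = `|s - t|,
        alpha a = x,
        alpha b = y
      & S = alpha @` [set` `[a, b]]].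

Definition is_metric_tree (R : realType) (M : metricType R) : Prop :=
  (forall x y : M, exists! S : set M, is_metric_segment x y S) /\
  (forall (x y z : M) (Sxz Szy Sxy : set M),
     is_metric_segment x z Sxz ->
     is_metric_segment z y Szy ->
     is_metric_segment x y Sxy ->
     Sxz `&` Szy = [set z] ->
     Sxz `|` Szy = Sxy).

(* The library's completeType is pointed, which would exclude the empty space. *)
Definition is_complete_metric (R : realType) (M : metricType R) : Prop :=
  forall u : nat -> M, cauchy (u @ \oo) -> exists l : M, u @ \oo --> l.

Definition is_metric_bounded (R : realType) (M : metricType R)
    (A : set M) : Prop :=
  exists r : R, forall x y, A x -> A y -> mdist x y <= r.

(* sup_(a in A) inf_(x in X) d(a, x), computed in [0, +oo]: the infimum over the
   empty set is +oo and, thanks to maxe 0, the supremum over the empty set is 0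
   (ereal_sup set0 is -oo). *)
Definition sup_inf_dist (R : realType) (M : metricType R)
    (A X : set M) : \bar R :=
  maxe 0%E
    (ereal_sup [set ereal_inf [set (mdist a x)%:E | x in X] | a in A]).

Definition compact_width (R : realType) (M : metricType R)
    (A : set M) : \bar R :=
  ereal_inf [set sup_inf_dist A X | X in [set X : set M | compact X]].

(* Main.v *)
Require Import Defs.
From mathcomp Require Import all_boot all_order all_algebra.
From mathcomp Require Import all_classical all_reals all_analysis.
From mathcomp Require Import lra.

(** Let w be the compact width, fix a root p, and move every a in A towards p
    along [p, a] by min(w, d(p, a)), giving a'; X0 is the closure of the set of
    all the a'.  If d(a, f) <= w + e then, [p, a] and [p, f] forming a tripod
    with centre m, d(a, m) <= w + e, so a' lies within e of [p, f].  Since A is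
    within w + e of some compact set for every e > 0, an ultrafilter on X0 thus
    contains, up to e, a neighbourhood of one single segment [p, f], hence a ball
    of radius of order e: it is Cauchy, and X0 is compact by completeness. *)

Set Implicit Arguments.
Unset Strict Implicit.
Unset Printing Implicit Defensive.

Import Order.TTheory GRing.Theory Num.Theory.
Import numFieldNormedType.Exports.

Local Open Scope classical_set_scope.
Local Open Scope ring_scope.

(** * Ultrafilters and compactness *)

(** Pigeonhole for ultrafilters: a choice of [k x] in [C] pushes [F] to an ultrafilter containing
    [C], which clusters at some [l] in [C]. One fixed [l] then serves, up to [e], for [F]-almost all
    [x]. *)
Lemma ultra_near_compact (R : realType) (T : Type) (K : pseudoMetricType R)
    (F : set_system T) (S : set T) (C : set K) (P : T -> K -> Prop) (e : R) :
  UltraFilter F -> F S -> compact C -> 0 < e ->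
  (forall x, S x -> exists2 k, C k & P x k) ->
  exists2 l, C l & F [set x | exists2 k, ball l e k & C k /\ P x k].
Proof.
move=> FU FS cC e0 SP.
have [x0 Sx0] := filter_ex FS.
have [k0 _ _] := SP _ Sx0.
(* [k0] is the default value of the choice function outside [S]. *)
have /choice[k kP] : forall x, exists k, S x -> C k /\ P x k.
  move=> x; have [/SP[k Ck Pk]|nSx] := pselect (S x); first by exists k.
  by exists k0.
have kFC : (k @ F) C by apply: (@filterS _ F _ S) FS => x /kP[].
have [l [Cl kl]] := cC _ (fmap_proper_filter k _) kFC; exists l => //.
(* An ultrafilter contains the preimage of the ball or its complement; the latter would keep [k @ F]
   away from its cluster point. *)
have [Fb|Fnb] := in_ultra_setVsetC (k @^-1` ball l e) FU.
  apply: filterS (filterI FS Fb) => x [/kP[Ckx Pkx] bkx].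
  by exists (k x).
have [y [/= nby by_]] := kl (~` ball l e) _ Fnb (nbhsx_ballx l e e0).
by [].
Qed.

(** Completeness is stated for sequences, so a Cauchy ultrafilter is replaced by the centres [u n]
    of balls of radius [1/(n+1)] that it contains. They form a Cauchy sequence, whose limit is also
    the limit of [F]. *)
Lemma complete_closed_compact (R : realType) (M : metricType R) (X : set M) :
  is_complete_metric M -> closed X ->
  (forall F : set_system M, UltraFilter F -> F X -> cauchy_ex F) ->
  compact X.
Proof.
move=> cM cX XF; rewrite compact_ultra => F FU FX.
have Fc := XF F FU FX.
have /choice[u Fu] : forall n : nat, exists x, F (ball x (n.+1%:R^-1 : R)).
  by move=> n; apply: Fc; rewrite invr_gt0.
have inv_lt (e : R) : 0 < e -> \forall n \near \oo, (n.+1%:R^-1 : R) < e.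
  by move=> e0; exact: near_infty_natSinv_lt (PosNum e0).
have [l ul] : exists l : M, u @ \oo --> l.
  apply: cM; apply: cauchy_exP => e e0.
  have /inv_lt[N _ Nlt] : 0 < e / 2 by rewrite divr_gt0.
  exists (u N); exists N => // n /= Nn.
  have [y [yN yn]] := filter_ex (filterI (Fu N) (Fu n)).
  apply: (@ball_splitr _ _ y).
    by apply: le_ball (ball_sym yN); apply/ltW/Nlt => /=.
  by apply: le_ball (ball_sym yn); apply/ltW/Nlt.
have Fl : F --> l.
  apply/fcvg_ballP => e e0.
  have e20 : 0 < e / 2 by rewrite divr_gt0.
  have [n [une ule]] := filter_ex (filterI (inv_lt _ e20) (cvg_ball ul e20)).
  apply: filterS (Fu n) => y uy; apply: (@ball_split _ _ (u n)) ule _.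
  by apply: le_ball uy; exact: ltW.
exists l; split => //; apply: cX => B /Fl FB.
by have [y] := filter_ex (filterI FX FB); exists y.
Qed.

(** * Geodesics, segments and branching in a metric tree *)

(** Parametrised by the distance to [x], so that a point common to two geodesics from the same root
    has the same parameter on both. *)
Definition geodesic (R : realType) (M : metricType R) (x y : M) (g : R -> M) :=
  [/\ g 0 = x, g (mdist x y) = y
    & forall s t, 0 <= s <= mdist x y -> 0 <= t <= mdist x y ->
        mdist (g s) (g t) = `|s - t|].

Lemma segment_geodesic (R : realType) (M : metricType R) (x y : M) S :
  is_metric_segment x y S -> exists g, geodesic x y g.
Proof.
move=> [a [b [g [ab gi ga gb _]]]].
have xy : mdist x y = b - a.
  rewrite -ga -gb gi ?in_itv/= ?lexx ?ab//.
  by rewrite distrC ger0_norm// subr_ge0.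
exists (fun t => g (a + t)); split; first by rewrite addr0.
  by rewrite xy addrC subrK.
rewrite xy => s t /andP[s0 sb] /andP[t0 tb].
by rewrite gi ?in_itv/=; [congr (`| _ |)|apply/andP; split..]; lra.
Qed.

Lemma is_metric_segment_sym (R : realType) (M : metricType R) (x y : M) S :
  is_metric_segment x y S -> is_metric_segment y x S.
Proof.
move=> [a [b [g [ab gi ga gb ->]]]]; exists (- b), (- a), (g \o -%R); split.
- by rewrite lerN2.
- move=> s t; rewrite !in_itv/= => /andP[s1 s2] /andP[t1 t2].
  by rewrite gi ?in_itv/= -?opprD ?normrN//; apply/andP; split; lra.
- by rewrite /= opprK.
- by rewrite /= opprK.
- apply/seteqP; split=> _ [t /= + <-]; rewrite in_itv/= => /andP[t1 t2].
    by exists (- t); rewrite /= ?opprK// in_itv/=; apply/andP; split; lra.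
  by exists (- t) => //; rewrite /= in_itv/=; apply/andP; split; lra.
Qed.

Lemma geodesic_segment (R : realType) (M : metricType R) (x y : M) g s t :
  geodesic x y g -> 0 <= s -> s <= t -> t <= mdist x y ->
  is_metric_segment (g s) (g t) (g @` [set` `[s, t]]).
Proof.
move=> [g0 g1 gi] s0 st ty; exists s, t, g; split => // u v.
rewrite !in_itv/= => /andP[u1 u2] /andP[v1 v2].
by apply: gi; apply/andP; split; lra.
Qed.

Lemma metric_segment_le (R : realType) (M : metricType R) (x y z : M) S :
  is_metric_segment x y S -> S z -> mdist x z <= mdist x y.
Proof.
move=> [a [b [g [ab gi <- <- ->]]]] [t /=]; rewrite in_itv/= => /andP[t1 t2] <-.
rewrite !gi ?in_itv/= ?lexx ?ab ?t1 ?t2//.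
by rewrite !(distrC a) !ger0_norm ?subr_ge0// lerB.
Qed.

(* The branching point is the last time [T] at which the two geodesics agree. *)
Lemma metric_tree_branch (R : realType) (M : metricType R) (p a f : M) ga gf :
  is_metric_tree M -> geodesic p a ga -> geodesic p f gf ->
  exists T, [/\ 0 <= T, T <= mdist p a, T <= mdist p f,
    ga T = gf T & mdist p a - T <= mdist a f].
Proof.
move=> [tree1 tree2] Ga Gf; have [ga0 ga1 gai] := Ga; have [gf0 gf1 gfi] := Gf.
pose E := [set t | [/\ 0 <= t, t <= mdist p a, t <= mdist p f & ga t = gf t]].
have E0 : E 0 by split; rewrite ?mdist_ge0// ga0 gf0.
have hE : has_sup E by split; [exists 0|exists (mdist p a) => t []].
pose T := sup E.
have T0 : 0 <= T by exact: ub_le_sup hE.2 _ E0.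
have Ta : T <= mdist p a by apply: ge_sup => [|t []]; first by exists 0.
have Tf : T <= mdist p f by apply: ge_sup => [|t []]; first by exists 0.
(* The supremum is attained: [ga T] and [gf T] are both within [e / 2] of a common point
   [ga t = gf t]. *)
have gT : ga T = gf T.
  apply: mdist_positivity; apply/eqP; rewrite eq_le mdist_ge0 andbT.
  apply/ler_addgt0Pl => e e0; rewrite addr0.
  have [t Et tT] := sup_adherent (divr_gt0 e0 (ltr0n R 2)) hE.
  have tT' : t <= T by exact: ub_le_sup hE.2 _ Et.
  have [t0 ta tf gt] := Et.
  apply: (le_trans (metric_triangle _ (ga t) _)).
  rewrite gai ?T0 ?t0// gt gfi ?T0 ?t0// (distrC t) ger0_norm ?subr_ge0//.
  by move: tT; rewrite -/T; lra.
exists T; split => //.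
have Sam := is_metric_segment_sym (geodesic_segment Ga T0 Ta (lexx _)).
have Smf := geodesic_segment Gf T0 Tf (lexx _).
rewrite ga1 in Sam; rewrite gf1 -gT in Smf.
have [Saf [afS _]] := tree1 a f.
(* By maximality of [T] these two segments meet only at [ga T], so the second tree axiom puts [ga T]
   on the segment from [a] to [f]. *)
have SE := tree2 _ _ _ _ _ _ Sam Smf afS.
have : Saf (ga T).
  rewrite -SE; first by left; exists T => //=; rewrite in_itv/= lexx Ta.
  apply/seteqP; split=> [z [[s /= + <-] [t /= + ]]|_ ->]; last first.
    split; exists T => //=; rewrite in_itv/= lexx ?Ta ?Tf//.
  rewrite !in_itv/= => /andP[Ts sa] /andP[Tt tf] gts.
  have s0 := le_trans T0 Ts; have t0 := le_trans T0 Tt.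
  have st : s = t.
    have sE : mdist p (ga s) = s.
      rewrite -ga0 gai ?lexx ?mdist_ge0 ?s0 ?sa//.
      by rewrite sub0r normrN ger0_norm.
    have tE : mdist p (gf t) = t.
      rewrite -gf0 gfi ?lexx ?mdist_ge0 ?t0 ?tf//.
      by rewrite sub0r normrN ger0_norm.
    by rewrite -sE -tE gts.
  have Es : E s by split; rewrite // -?gts st.
  have sT : s <= T by exact: ub_le_sup hE.2 _ Es.
  by congr ga; apply/eqP; rewrite eq_le sT.
move=> /(metric_segment_le afS); apply: le_trans.
rewrite -[X in mdist X (ga T)]ga1 gai ?lexx ?mdist_ge0 ?T0 ?Ta//.
by rewrite ger0_norm ?subr_ge0.
Qed.

(** The moved point either precedes the branching point, hence lies on [[p, f]] by uniqueness of
    segments, or is at distance [(mdist p a - T) - w <= mdist a f - w <= e] beyond it. *)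
Lemma metric_tree_retract (R : realType) (M : metricType R) (p a f : M) ga gf
    (w e : R) :
  is_metric_tree M -> geodesic p a ga -> geodesic p f gf -> 0 <= w -> 0 <= e ->
  mdist a f <= w + e ->
  exists2 t, 0 <= t <= mdist p f &
    mdist (ga (Num.max 0 (mdist p a - w))) (gf t) <= e.
Proof.
move=> tM Ga Gf w0 e0 afwe.
have [T [T0 Ta Tf gT aT]] := metric_tree_branch tM Ga Gf.
set s := Num.max 0 _.
have s0 : 0 <= s by rewrite le_max lexx.
have [sT|Ts] := leP s T.
  have Sa := geodesic_segment Ga (lexx 0) T0 Ta.
  have Sf := geodesic_segment Gf (lexx 0) T0 Tf.
  have [[ga0 _ _] [gf0 _ _]] := (Ga, Gf).
  rewrite ga0 in Sa; rewrite gf0 -gT in Sf.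
  have [S [_ Su]] := tM.1 p (ga T).
  have : (ga @` [set` `[0, T]]) (ga s).
    by exists s => //=; rewrite in_itv/= s0.
  rewrite -(Su _ Sa) (Su _ Sf) => -[t /=]; rewrite in_itv/= => /andP[t0 tT] <-.
  by exists t; rewrite ?mdistxx// t0 (le_trans tT).
have sE : s = mdist p a - w.
  by apply/max_idPr; move: Ts; rewrite lt_max ltNge T0 => /ltW; exact: le_trans.
exists T; first by rewrite T0.
have [_ _ gai] := Ga.
have sT : T <= s := ltW Ts.
have sa : s <= mdist p a by rewrite sE gerBl.
rewrite -gT gai ?s0 ?T0//.
by rewrite ger0_norm ?subr_ge0// sE; lra.
Qed.

(** * Compact width and the optimal compact set *)

Lemma sup_inf_dist_lt (R : realType) (M : metricType R) (A X : set M) (r : R) a :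
  (sup_inf_dist A X < r%:E)%E -> A a -> exists2 x, X x & mdist a x < r.
Proof.
rewrite gt_max => /andP[_ Xr] Aa.
have /ereal_inf_ltP[_ [x Xx <-] axr] :
    (ereal_inf [set (mdist a x)%:E | x in X] < r%:E)%E.
  by apply: le_lt_trans Xr; apply: ereal_sup_ubound; exists a.
by exists x.
Qed.

Lemma compact_width_ge0 (R : realType) (M : metricType R) (A : set M) :
  (0 <= compact_width A)%E.
Proof. by apply/ereal_infP => _ [X _ <-]; rewrite le_max lexx. Qed.

Theorem corollary2p17 (R : realType) (M : metricType R)
    (hcomplete : is_complete_metric M) (htree : is_metric_tree M)
    (A : set M) (hA : is_metric_bounded A) :
  exists X0 : set M, compact X0 /\ sup_inf_dist A X0 = compact_width A.
Proof.
suff [X0 cX0 X0w] : exists2 X0 : set M, compact X0 &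
    (sup_inf_dist A X0 <= compact_width A)%E.
  exists X0; split => //; apply/eqP; rewrite eq_le X0w/=.
  by apply: ereal_inf_lbound; exists X0.
have w0 := compact_width_ge0 A.
have [[p Ap]|A0] := pselect (A !=set0); last first.
  exists set0; first exact: compact0.
  rewrite ge_max w0; apply: ge_ereal_sup => _ [a Aa <-].
  by case: A0; exists a.
case wE : (compact_width A) w0 => [w| |] // w0; last first.
  by exists set0; [exact: compact0|rewrite leey].
rewrite lee_fin in w0.
pose S := [set x | exists a g, [/\ A a, geodesic p a g
  & x = g (Num.max 0 (mdist p a - w))]].
(* The bound on the width is direct: each [a] is within [w] of its own moved point. Compactness
   remains. *)
exists (closure S); last first.
  rewrite ge_max lee_fin w0/=; apply: ge_ereal_sup => _ [a Aa <-].
  have [T [pT _]] := htree.1 p a.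
  have [g [g0 g1 gi]] := segment_geodesic pT.
  set s := Num.max 0 (mdist p a - w).
  have [s0 sp sw] : [/\ 0 <= s, s <= mdist p a & mdist p a - s <= w].
    have pa0 := mdist_ge0 p a.
    by rewrite /s maxEle; case: (leP 0 (_ - w)) => ?; split; lra.
  apply: ge_ereal_inf; exists (mdist a (g s))%:E.
    by exists (g s) => //; apply: subset_closure; exists a, g.
  rewrite lee_fin -[X in mdist X (g s)]g1 gi ?s0 ?lexx ?mdist_ge0//.
  by rewrite ger0_norm// subr_ge0.
apply: complete_closed_compact => //; first exact: closed_closure.
move=> F FU FS e e0.
(* Error budget: [d] from [x] to a moved point, [2 * d] from there to [[p, f]], [d] along [[p, f]];
   in total [4 * d < e]. *)
have d0 : 0 < e / 5 by rewrite divr_gt0.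
set d := e / 5 in d0.
have [X cX Xw] : exists2 X, compact X & (sup_inf_dist A X < (w + d)%:E)%E.
  have /ereal_inf_ltP[_ [X cX <-] Xw] : (compact_width A < (w + d)%:E)%E.
    by rewrite wE lte_fin ltrDl.
  by exists X.
have SX x : closure S x -> exists2 f, X f & exists a g,
    [/\ mdist a f < w + d, geodesic p a g
      & mdist x (g (Num.max 0 (mdist p a - w))) < d].
  move=> /(_ (ball x d) (nbhsx_ballx _ _ d0))[_ [[a [g [Aa pg ->]]]]].
  rewrite ballEmdist/= => xd.
  have [f Xf af] := sup_inf_dist_lt Xw Aa.
  by exists f => //; exists a, g.
(* First pigeonhole, over [X]: a single endpoint [f] for [F]-almost all [x]. *)
have [f Xf Ff] := ultra_near_compact FU FS cX d0 SX.
have [T [pT _]] := htree.1 p f.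
have [gf Gf] := segment_geodesic pT.
set S' := [set _ | _] in Ff.
have S'P x : S' x -> exists2 t : R, `[0, mdist p f]%classic t &
    mdist x (gf t) < 3 * d.
  move=> [k]; rewrite ballEmdist/= => fk [_ [a [g [ak Ga xa]]]].
  have afd : mdist a f <= w + 2 * d.
    apply: (le_trans (metric_triangle _ k _)); rewrite (metric_sym k).
    by move: fk ak; lra.
  have d20 : 0 <= 2 * d by rewrite mulr_ge0// ltW.
  have [t t01 gt] := metric_tree_retract htree Ga Gf w0 d20 afd.
  exists t; first by rewrite /= in_itv.
  apply: (le_lt_trans (metric_triangle _ (g (Num.max 0 (mdist p a - w))) _)).
  by move: xa gt; lra.
(* Second pigeonhole, over the parameter interval of [[p, f]]: a single [t], and [gf t] is the
   centre of the required ball. *)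
have [t] := ultra_near_compact FU Ff (@segment_compact _ 0 (mdist p f)) d0 S'P.
rewrite /= in_itv/= => t01 Ft.
exists (gf t); rewrite ballEmdist; apply: filterS Ft => x [s].
rewrite /ball/= => ts; rewrite in_itv/= => -[s01 xs].
have [_ _ gfi] := Gf.
apply: (le_lt_trans (metric_triangle _ (gf s) _)).
rewrite gfi// (metric_sym (gf s)).
by move: ts xs; rewrite /d; lra.
Qed.
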